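(* Let $J$ be a finite set, and let $\{\pi^i_j : B_i \to B_{ij}=B_{ji}\}_{i,j\in J,\, i\neq j}$ be a distributive family of algebra homomorphisms. Then the following statements are equivalent: (1) The family $\{\pi^i_j\}_{i,j\in J,\, i\ne j}$ satisfies the cocycle condition. (2) For any $K\subsetneq J$, any $k\in J\setminus K$, and any $(b_l)_{l\in K}\in\prod_{l\in K}B_l$ such that $\pi^i_j(b_i)=\pi^j_i(b_j)$ for all distinct $i,j\in K$, there exists $b_k\in B_k$ such that $\pi^l_k(b_l)=\pi^k_l(b_k)$ for all $l\in K$. (3) For all distinct $i,j,k\in J$ and all $b_i\in B_i$, $b_j\in B_j$ such that $\pi^i_j(b_i)=\pi^j_i(b_j)$, there exists $b_k\in B_k$ such that also $\pi^i_k(b_i)=\pi^k_i(b_k)$ and $\pi^j_k(b_j)=\pi^k_j(b_k)$.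
   Context: Algebras are associative algebras over a fixed commutative ground ring, and ideals are two-sided. The data are: a finite index set $J$, an algebra $B_i$ for each $i\in J$, an algebra $B_{ij}=B_{ji}$ for each pair of distinct $i,j\in J$ (the same algebra for both orders of the indices), and an algebra homomorphism $\pi^i_j:B_i\to B_{ij}$ for each ordered pair of distinct $i,j\in J$. Distributive family: the family $\{\pi^i_j\}$ is called distributive if all the $\pi^i_j$ are surjective and their kernels generate a distributive lattice of ideals. That is, for each $i\in J$, the ideals $\ker\pi^i_j$ of $B_i$ ($j\in J\setminus\{i\}$) generate, under the operations $+$ (sum of ideals) and $\cap$ (intersection), a distributive lattice of ideals of $B_i$. Cocycle condition (for a family of surjective homomorphisms): For distinct $i,j,k\in J$ put $B^i_{jk}:=B_i/(\ker\pi^i_j+\ker\pi^i_k)$ (so $B^i_{jk}=B^i_{kj}$), and let $[\cdot]^i_{jk}:B_i\to B^i_{jk}$ be the canonical surjection. There are isomorphisms $$\pi^{ij}_k: B^i_{jk}\longrightarrow B_{ij}/\pi^i_j(\ker\pi^i_k),\qquad [b_i]^i_{jk}\longmapsto \pi^i_j(b_i)+\pi^i_j(\ker\pi^i_k).$$ The family $\{\pi^i_j\}$ satisfies the cocycle condition if, for all distinct $i,j,k\in J$: (a) $\pi^i_j(\ker\pi^i_k)=\pi^j_i(\ker\pi^j_k)$ (as subsets of $B_{ij}=B_{ji}$); and (b) the isomorphisms $\phi^{ij}_k:=(\pi^{ij}_k)^{-1}\circ\pi^{ji}_k: B^j_{ik}\to B^i_{jk}$ (which are well defined because of (a)) satisfy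 $\phi^{ik}_j=\phi^{ij}_k\circ\phi^{jk}_i$. *)

(* Defs.v *)
From HB Require Import structures.
From mathcomp Require Import all_boot all_order all_algebra.
From mathcomp Require Import all_classical.

Set Implicit Arguments.
Unset Strict Implicit.
Unset Printing Implicit Defensive.

Import GRing.Theory.

Local Open Scope classical_set_scope.
Local Open Scope ring_scope.

(* Associative algebras, not assumed to be unital and possibly zero; the
   product is the semigroup law [*%g]. *)
HB.mixin Record Lmodule_isAssocAlgebra (R : comPzRingType) V
    of GRing.Lmodule R V & Semigroup V := {
  amulDl : left_distributive *%g (@GRing.add V);
  amulDr : right_distributive *%g (@GRing.add V);
  ascaleAl : forall (a : R) (x y : V), a *: (x * y)%g = ((a *: x)%R * y)%g;
  ascaleAr : forall (a : R) (x y : V), a *: (x * y)%g = (x * (a *: y)%R)%g }.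

#[short(type="assocAlgType")]
HB.structure Definition AssocAlgebra (R : comPzRingType) :=
  {V of GRing.Lmodule R V & Semigroup V & Lmodule_isAssocAlgebra R V}.

HB.structure Definition AlgHom (R : comPzRingType) (A B : assocAlgType R) :=
  {f of @GRing.Linear R A B *:%R f & @Multiplicative A B f}.

Notation "{ 'ahom' A -> B }" := (AlgHom.type A B)
  (at level 0, A at level 98, B at level 99, format "{ 'ahom'  A  ->  B }").

Section Ideals.
Context {V : zmodType}.
Implicit Types (I K : set V) (x : V).

Definition add_set I K : set V := [set x + y | x in I & y in K].

Definition coset I x : set V := [set x + y | y in I].

(* V / I as the set of cosets of I, so that equal ideals have literally equal
   quotients. *)
Definition quot I : set (set V) := range (coset I).

Definition generated_lattice (G : set (set V)) : set (set V) :=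
  smallest [set L | forall I K, L I -> L K ->
                      L (add_set I K) /\ L (I `&` K)] G.

Definition distributive_lattice (L : set (set V)) : Prop :=
  forall I K M, L I -> L K -> L M ->
    I `&` add_set K M = add_set (I `&` K) (I `&` M).

End Ideals.

Definition kernel {U V : zmodType} (f : U -> V) : set U := [set x | f x = 0].

Unset Implicit Arguments.

(* The algebra B_ij = B_ji is B2 [set i; j], indexed by the unordered pair.
   The values of B2 outside two-element sets and the homomorphisms pi i i play
   no role: every family given only for i != j extends by zero algebras and
   zero maps. *)
Section Family.
Context {R : comPzRingType} {J : finType}.
Context {B : J -> assocAlgType R} {B2 : {set J} -> assocAlgType R}.
Variable pi : forall i j : J, {ahom B i -> B2 [set i; j]%SET}.

(* The identity B_ji = B_ij, needed since [set j; i] and [set i; j] are equal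
   but not convertible. *)
Definition flip (j i : J) (x : B2 [set j; i]%SET) : B2 [set i; j]%SET :=
  ecast e (B2 e) (finset.setUC [set j]%SET [set i]%SET) x.

Definition ker (i j : J) : set (B i) := kernel (pi i j).

Definition surjective_family : Prop :=
  forall i j, i != j -> range (pi i j) = setT.

Definition distributive_family : Prop :=
  surjective_family /\
  forall i, distributive_lattice
              (generated_lattice [set ker i j | j in [set j | j != i]]).

Definition Bq (i j k : J) : set (set (B i)) :=
  quot (add_set (ker i j) (ker i k)).

(* [pi_quotE] and [pi_quot_bij] below: this sends the class of b to the class
   of pi i j b, and is a bijection from Bq i j k onto B_ij / pi i j (ker i k). *)
Definition pi_quot (i j k : J) (X : set (B i)) : set (B2 [set i; j]%SET) :=
  \bigcup_(b in X) coset (pi i j @` ker i k) (pi i j b).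

Definition pi_quot_inv (i j k : J) : set (B2 [set i; j]%SET) -> set (B i) :=
  'pinv_(fun=> set0) (Bq i j k) (pi_quot i j k).

(* The map Bq j i k -> Bq i j k obtained by identifying the codomain of
   pi_quot j i k with that of pi_quot i j k, legitimate once
   pi i j @` ker i k and pi j i @` ker j k agree in B_ij. *)
Definition phi (i j k : J) (X : set (B j)) : set (B i) :=
  pi_quot_inv i j k (flip j i @` pi_quot j i k X).

Definition cocycle_condition : Prop :=
  forall i j k, i != j -> i != k -> j != k ->
    pi i j @` ker i k = flip j i @` (pi j i @` ker j k) /\
    {in Bq k i j, phi i k j =1 phi i j k \o phi j k i}.

Definition compatible (i j : J) (bi : B i) (bj : B j) : Prop :=
  pi i j bi = flip j i (pi j i bj).

Lemma pi_quotE i j k (b : B i) :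
  pi_quot i j k (coset (add_set (ker i j) (ker i k)) b) =
  coset (pi i j @` ker i k) (pi i j b).
Proof.
apply/seteqP; split=> [y [_ [_ [u ku [v kv <-]] <-]] [_ [w kw <-] <-]|y].
  exists (pi i j (v + w)); last first.
    by rewrite !raddfD /= [pi i j u]ku add0r addrA.
  by exists (v + w) => //; rewrite /ker /kernel /= raddfD /= kv kw addr0.
move=> by_; exists b => //; exists 0; last by rewrite addr0.
by exists 0; [exact: raddf0|exists 0; [exact: raddf0|rewrite addr0]].
Qed.

Lemma pi_quot_bij i j k : range (pi i j) = setT ->
  set_bij (Bq i j k) (quot (pi i j @` ker i k)) (pi_quot i j k).
Proof.
move=> pi_surj; split.
- by move=> _ [b _ <-] /=; rewrite pi_quotE; exists (pi i j b).
- have sub b c : coset (pi i j @` ker i k) (pi i j c) (pi i j b) ->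
      coset (add_set (ker i j) (ker i k)) b `<=`
      coset (add_set (ker i j) (ker i k)) c.
    move=> [_ [v kv <-] cvb] x [_ [u1 ku1 [v1 kv1 <-]] <-].
    have [u -> ku] : exists2 u, b = c + (u + v) & ker i j u.
      exists (b - c - v); first by rewrite subrK addrC subrK.
      by rewrite /ker /kernel /= !raddfB /= -cvb [_ + pi i j v]addrC addrK subrr.
    rewrite -addrA addrACA; exists (u + u1 + (v + v1)) => //.
    exists (u + u1); first by rewrite /ker /kernel /= raddfD /= ku ku1 addr0.
    by exists (v + v1) => //; rewrite /ker /kernel /= raddfD /= kv kv1 addr0.
  have self b : coset (pi i j @` ker i k) (pi i j b) (pi i j b).
    by exists 0; [exists 0; exact: raddf0|rewrite addr0].
  move=> X Y /set_mem[b _ <-] /set_mem[c _ <-]; rewrite !pi_quotE => bc.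
  by apply/seteqP; split; apply: sub; [rewrite -bc|rewrite bc].
- move=> _ [y _ <-].
  have [b _ <-] : range (pi i j) y by rewrite pi_surj.
  exists (coset (add_set (ker i j) (ker i k)) b); first by exists b.
  exact: pi_quotE.
Qed.

End Family.

(* Main.v *)
(* Lift the b_l (l in K) arbitrarily to elements c_l of B_k.  Then (3) says
   c_l - c_m lies in ker k l + ker k m, so (2) is the Chinese remainder theorem
   for the ideals ker k l, which holds when these generate a distributive
   lattice.  The equivalence of (1) and (3) rests on phi i j k mapping the class
   of b_j to the class of b_i as soon as b_i and b_j are compatible. *)
Require Import Defs.
From mathcomp Require Import all_boot all_order all_algebra.
From mathcomp Require Import all_classical.

Set Implicit Arguments.
Unset Strict Implicit.
Unset Printing Implicit Defensive.

Import GRing.Theory.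

Local Open Scope classical_set_scope.
Local Open Scope ring_scope.

(** * Sums and intersections of additive subgroups, and the lattice they generate *)

Section DistributiveLattice.
Context {V : zmodType}.
Implicit Types (I K M : set V) (G L : set (set V)).

Definition subgroup_set I := I 0 /\ forall x y, I x -> I y -> I (x - y).

Lemma subgroup_setD I x y : subgroup_set I -> I x -> I y -> I (x + y).
Proof.
move=> [I0 IB] Ix Iy; rewrite -[y]opprK -[- y]sub0r.
exact: IB Ix (IB _ _ I0 Iy).
Qed.

Lemma subgroup_setN I x : subgroup_set I -> I x -> I (- x).
Proof. by move=> [I0 IB] Ix; rewrite -sub0r; exact: IB. Qed.

Lemma subgroup_kernel (U : zmodType) (f : {additive V -> U}) :
  subgroup_set (kernel f).
Proof.
split; first exact: raddf0.
by move=> x y; rewrite /kernel /= raddfB => -> ->; rewrite subrr.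
Qed.

Lemma subgroup_add_set I K :
  subgroup_set I -> subgroup_set K -> subgroup_set (add_set I K).
Proof.
move=> [I0 IB] [K0 KB]; split; first by exists 0 => //; exists 0; rewrite ?addr0.
move=> _ _ [x Ix [y Ky <-]] [x' Ix' [y' Ky' <-]].
by exists (x - x'); [exact: IB|exists (y - y'); [exact: KB|rewrite opprD addrACA]].
Qed.

Lemma subgroup_setI I K :
  subgroup_set I -> subgroup_set K -> subgroup_set (I `&` K).
Proof.
move=> [I0 IB] [K0 KB]; split=> // x y [Ix Kx] [Iy Ky].
by split; [exact: IB|exact: KB].
Qed.

Lemma add_setC I K : add_set I K = add_set K I.
Proof.
by apply/seteqP; split=> _ [x Ix [y Ky <-]];
  exists y => //; exists x; rewrite // addrC.
Qed.

(** Once the gap [c - b] is split as [u + v], moving [b] by [v] leaves only the error [- u] against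
    [c]. Corrections of this kind yield both the simultaneous solutions of congruences and the
    common extensions below. *)
Lemma addrB_eqN (b c u v : V) : u + v = c - b -> b + v - c = - u.
Proof.
move=> uv; have -> : v = c - b - u by rewrite -uv addrAC subrr add0r.
by rewrite addrA [b + _]addrC subrK addrAC subrr add0r.
Qed.

Lemma coset_eq_sub I x y : subgroup_set I -> coset I x = coset I y -> I (x - y).
Proof.
move=> [I0 _] xy; have: coset I y x by rewrite -xy; exists 0; rewrite ?addr0.
by case=> z Iz <-; rewrite addrAC subrr add0r.
Qed.

(** Subgroups are closed under both lattice operations, so minimality of the generated lattice
    applies. *)
Lemma generated_lattice_subgroup G I :
  (forall K, G K -> subgroup_set K) -> generated_lattice G I -> subgroup_set I.
Proof.
move=> sG; apply: smallest_sub => // K M sK sM.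
by split; [exact: subgroup_add_set|exact: subgroup_setI].
Qed.

Lemma sub_generated_lattice G : G `<=` generated_lattice G.
Proof. by move=> I GI L [_]; exact. Qed.

Lemma generated_latticeI G I K : generated_lattice G I ->
  generated_lattice G K -> generated_lattice G (I `&` K).
Proof.
move=> GI GK L [Lc GL].
by have [] := Lc I K (GI L (conj Lc GL)) (GK L (conj Lc GL)).
Qed.

Lemma generated_latticeD G I K : generated_lattice G I ->
  generated_lattice G K -> generated_lattice G (add_set I K).
Proof.
move=> GI GK L [Lc GL].
by have [] := Lc I K (GI L (conj Lc GL)) (GK L (conj Lc GL)).
Qed.

(** * Chinese remainder theorem in a distributive lattice of subgroups *)

Section Generated.
Variable G : set (set V).
Hypothesis sG : forall K, G K -> subgroup_set K.
Hypothesis dG : distributive_lattice (generated_lattice G).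
Let L := generated_lattice G.

(** Distributing [add_set I K] over [I] and [M] splits off a summand in [I]; distributing [M] over
    [I] and [K] splits the remaining one into a part in [I] and a part in both [K] and [M]. *)
Lemma distributive_dual I K M : L I -> L K -> L M ->
  add_set I K `&` add_set I M `<=` add_set I (K `&` M).
Proof.
move=> LI LK LM; have sI := generated_lattice_subgroup sG LI.
rewrite (dG (generated_latticeD LI LK) LI LM) => _ [x [_ Ix] [y [IKy My] <-]].
have: (M `&` add_set I K) y by [].
rewrite (dG LM LI LK) => -[u [_ Iu] [v [Mv Kv] <-]].
exists (x + u); first exact: subgroup_setD.
by exists v; rewrite ?addrA.
Qed.

Context {T : eqType} (I : T -> set V).

(** Iterating the dual law lets [A] be the intersection of the [I m]. The fixed entry [m0] keeps the
    list nonempty: an empty intersection would be all of [V], which need not belong to [L]. *)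
Lemma distributive_bigI M x m0 (s : seq T) : L M ->
  (forall m, m \in m0 :: s -> L (I m) /\ add_set M (I m) x) ->
  exists A, [/\ L A, add_set M A x & forall m, m \in m0 :: s -> A `<=` I m].
Proof.
move=> LM; elim: s => [|m s IHs] H.
  have [LI Mx] := H m0 (mem_head _ _).
  by exists (I m0); split=> // m; rewrite inE => /eqP ->.
have [m' m's|A [LA Ax As]] := IHs.
  by apply: H; move: m's; rewrite !inE => /orP[->//|->]; rewrite !orbT.
have [LI Mx] : L (I m) /\ add_set M (I m) x by apply: H; rewrite !inE eqxx orbT.
exists (I m `&` A); split; first exact: generated_latticeI.
  exact: distributive_dual.
move=> m'; rewrite !inE => /or3P[m'm0|/eqP -> y []//|m's] y [_ Ay];
  by apply: As Ay; rewrite !inE ?m'm0 ?m's ?orbT.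
Qed.

(** By induction, [b] solves the congruences for the tail. Then [c l - b] lies in the sum of [I l]
    and each [I m] of the tail, hence equals [u + v] with [u] in [I l] and [v] in all these [I m];
    so [b + v] solves every congruence. *)
Lemma distributive_chinese_remainder (c : T -> V) (s : seq T) :
  (forall m, m \in s -> L (I m)) ->
  (forall l m, l \in s -> m \in s -> add_set (I l) (I m) (c l - c m)) ->
  exists b, forall m, m \in s -> I m (b - c m).
Proof.
elim: s => [|l s IHs] LI Hc; first by exists 0.
have [m ms|l' m l's ms|b bs] := IHs.
- by apply: LI; rewrite inE ms orbT.
- by apply: Hc; rewrite inE ?l's ?ms orbT.
have sI m : m \in l :: s -> subgroup_set (I m).
  by move=> /LI; exact: generated_lattice_subgroup.
case: s => [|m0 s] in LI Hc bs sI {IHs} *.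
  exists (c l) => m; rewrite inE => /eqP ->; rewrite subrr.
  by case: (sI l); rewrite ?mem_head.
have [m ms|A [LA [u Iu [v Av uv]] As]] :=
    @distributive_bigI (I l) (c l - b) m0 s (LI l (mem_head _ _)).
  have ms' : m \in l :: m0 :: s by rewrite inE ms orbT.
  split; first exact: LI.
  (* Replacing [c m] by [b] in [c l - c m] changes it by an element of [I m], which the second
     summand absorbs. *)
  have [u Iu [v Iv uv]] := Hc l m (mem_head _ _) ms'.
  exists u => //; exists (v - (b - c m)).
    by case: (sI m ms') => _; apply => //; exact: bs.
  by rewrite addrA uv opprB addrA subrK.
exists (b + v) => m; rewrite inE => /orP[/eqP ->|ms].
  rewrite (addrB_eqN uv).
  by apply: subgroup_setN Iu; apply: sI; rewrite mem_head.
rewrite addrAC; apply: subgroup_setD; last exact: As Av.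
  by apply: sI; rewrite inE ms orbT.
exact: bs.
Qed.

End Generated.
End DistributiveLattice.

(** * Compatible elements and the maps between the quotients *)

Section Family.
Context {R : comPzRingType} {J : finType}.
Context {B : J -> assocAlgType R} {B2 : {set J} -> assocAlgType R}.
Variable pi : forall i j : J, {ahom B i -> B2 [set i; j]%SET}.

Lemma flipK i j : cancel (flip (B2 := B2) j i) (flip i j).
Proof.
(* With the index set generalized, one equality proof can be eliminated; the other becomes a loop,
   trivial by uniqueness of equality proofs on a type with decidable equality. *)
rewrite /flip; move: (finset.setUC _ _) (finset.setUC _ _).
move: [set i; j]%SET => S e; case: _ / e => e x.
by rewrite (eq_irrelevance e erefl).
Qed.

Lemma compatible_sym i j bi bj : compatible pi i j bi bj -> compatible pi j i bj bi.
Proof. by rewrite /compatible => ->; rewrite flipK. Qed.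

Lemma flip_image_coset i j I (x : B2 [set j; i]%SET) :
  flip j i @` coset I x = coset (flip j i @` I) (flip j i x).
Proof.
rewrite /flip; move: (finset.setUC _ _) => e; case: _ / e => /=.
by rewrite !image_id.
Qed.

Lemma subgroup_ker i j : subgroup_set (ker pi i j).
Proof. exact: subgroup_kernel. Qed.

Lemma ker_coset i j b c : ker pi i j (b - c) <-> pi i j b = pi i j c.
Proof.
rewrite /ker /kernel /= raddfB; split=> [/subr0_eq//|bc].
by apply/eqP; rewrite subr_eq0; apply/eqP.
Qed.

(** This turns compatibility with [bi] into a congruence modulo a kernel, as soon as one compatible
    element is known. *)
Lemma compatible_ker i j bi bj c : compatible pi i j bi bj ->
  compatible pi i j bi c <-> ker pi j i (c - bj).
Proof.
move=> bibj; split=> [/compatible_sym bic | /ker_coset cbj].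
  by apply/ker_coset; rewrite bic -(compatible_sym bibj).
by rewrite /compatible cbj.
Qed.

Lemma compatible0 i j bi : compatible pi i j bi 0 <-> ker pi i j bi.
Proof.
have flip0 : flip j i 0 = 0 :> B2 [set i; j]%SET.
  by rewrite /flip; case: _ / (finset.setUC _ _).
by rewrite /compatible /ker /kernel /= raddf0 flip0.
Qed.

Lemma compatible_surj : surjective_family pi -> forall i j (bi : B i), i != j ->
  exists bj, compatible pi i j bi bj.
Proof.
move=> surj i j bi ij; have ji : j != i by rewrite eq_sym.
have [b _ bE] : range (pi j i) (flip i j (pi i j bi)) by rewrite surj.
by exists b; rewrite /compatible bE flipK.
Qed.

(** Compatible elements have the same image in the algebra of the pair, hence, by the equality of
    kernel images, the same class in its quotient; injectivity of [pi_quot] then recovers the class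
    of [bi]. *)
Lemma phi_coset i j k (bi : B i) (bj : B j) : range (pi i j) = setT ->
  pi i j @` ker pi i k = flip j i @` (pi j i @` ker pi j k) ->
  compatible pi i j bi bj ->
  phi pi i j k (coset (add_set (ker pi j i) (ker pi j k)) bj) =
  coset (add_set (ker pi i j) (ker pi i k)) bi.
Proof.
move=> surj kerE comp; rewrite /phi pi_quotE flip_image_coset -kerE -comp.
rewrite -pi_quotE /pi_quot_inv pinvKV //; last by apply: mem_set; exists bi.
by have [] := pi_quot_bij pi i j k surj.
Qed.

(** * Cocycle condition and extension of compatible pairs to triples *)

Definition triple_extension :=
  forall (i j k : J) (bi : B i) (bj : B j), i != j -> i != k -> j != k ->
  compatible pi i j bi bj ->
  exists bk : B k, compatible pi i k bi bk /\ compatible pi j k bj bk.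

(** Choose [bk] compatible with [bi], and [bk'] with [bj]. The class of [bj] goes directly to that
    of [bk'], and through the class of [bi] to that of [bk]. The cocycle identity equates the two,
    so [bk' - bk] is a sum [u + v] from the two kernels, and [bk + v] is compatible with both
    elements. *)
Lemma cocycle_triple_extension : surjective_family pi ->
  cocycle_condition pi -> triple_extension.
Proof.
move=> surj cocycle i j k bi bj ij ik jk comp_ij.
have [ji ki kj] : [/\ j != i, k != i & k != j] by split; rewrite eq_sym.
have [bk comp_ik] := compatible_surj surj bi ik.
have [bk' comp_jk] := compatible_surj surj bj jk.
have [kerE_kij phiE] := cocycle k i j ki kj ij.
have [kerE_ijk _] := cocycle i j k ij ik jk.
have [kerE_kji _] := cocycle k j i kj ki ji.
have /phiE/= : coset (add_set (ker pi j k) (ker pi j i)) bj \in Bq pi j k i.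
  by apply: mem_set; exists bj.
rewrite (phi_coset (surj _ _ kj) kerE_kji (compatible_sym comp_jk)) /=.
rewrite [add_set (ker pi j k) _]add_setC (phi_coset (surj _ _ ij) kerE_ijk comp_ij).
rewrite [add_set (ker pi i j) _]add_setC.
rewrite (phi_coset (surj _ _ ki) kerE_kij (compatible_sym comp_ik)).
rewrite [add_set (ker pi k i) _]add_setC.
move/(coset_eq_sub (subgroup_add_set (subgroup_ker k j) (subgroup_ker k i))).
case=> u ku [v kv uv].
exists (bk + v); split.
  by apply/(compatible_ker _ comp_ik); rewrite addrAC subrr add0r.
apply/(compatible_ker _ comp_jk).
rewrite (addrB_eqN uv).
exact: subgroup_setN (subgroup_ker k j) ku.
Qed.

Lemma triple_extension_cocycle : surjective_family pi ->
  triple_extension -> cocycle_condition pi.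
Proof.
move=> surj ext.
(* An element [b] of [ker pi i k] is compatible with [0] in [B k]; extending this pair to [B j]
   gives an element of [ker pi j k] with the same image as [b]. *)
have sub i j k : i != j -> i != k -> j != k ->
    forall b, ker pi i k b -> exists2 c, ker pi j k c & compatible pi i j b c.
  move=> ij ik jk b kb; have kj : k != j by rewrite eq_sym.
  have [c [bc /compatible_sym/compatible0 kc]] :=
    ext i k j b 0 ik ij kj (iffRL (compatible0 _ _) kb).
  by exists c.
have kerE i j k : i != j -> i != k -> j != k ->
    pi i j @` ker pi i k = flip j i @` (pi j i @` ker pi j k).
  move=> ij ik jk; have ji : j != i by rewrite eq_sym.
  apply/seteqP; split=> [_ [b kb <-]|_ [_ [c kc <-] <-]].
    by have [c kc ->] := sub _ _ _ ij ik jk b kb; exists (pi j i c) => //; exists c.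
  have [b kb /compatible_sym <-] := sub _ _ _ ji jk ik c kc.
  by exists b.
move=> i j k ij ik jk; split; first exact: kerE.
have [ji ki kj] : [/\ j != i, k != i & k != j] by split; rewrite eq_sym.
move=> _ /set_mem[bk _ <-] /=.
(* A pairwise compatible triple through [bk] is built, so that all three maps send classes of its
   members to one another. *)
have [bj /compatible_sym comp_jk] := compatible_surj surj bk kj.
have [bi [/compatible_sym comp_ij /compatible_sym comp_ik]] :=
  ext j k i bj bk jk ji ki comp_jk.
rewrite (phi_coset (surj _ _ ik) (kerE _ _ _ ik ij kj) comp_ik).
rewrite [add_set (ker pi k i) _]add_setC.
rewrite (phi_coset (surj _ _ jk) (kerE _ _ _ jk ji ki) comp_jk).
rewrite [add_set (ker pi j k) _]add_setC.
rewrite (phi_coset (surj _ _ ij) (kerE _ _ _ ij ik jk) comp_ij).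
by rewrite add_setC.
Qed.

(** * From triples to arbitrary compatible families *)

Lemma triple_extension_family : distributive_family pi -> triple_extension ->
  forall (K : {set J}) (k : J) (b : forall l, B l), k \notin K ->
    (forall i j, i \in K -> j \in K -> i != j -> compatible pi i j (b i) (b j)) ->
  exists bk : B k, forall l, l \in K -> compatible pi l k (b l) bk.
Proof.
move=> [surj distr] ext K k b kK comp.
have neq l : l \in K -> l != k by apply: contraTneq => ->.
(* The choice function must be total on [J]; outside [K] the value [0] serves. *)
have /choice[c cP] l : exists c, l \in K -> compatible pi l k (b l) c.
  have [lK|] := boolP (l \in K); last by exists 0.
  by have [c] := compatible_surj surj (b l) (neq l lK); exists c.
have [|l|l m|x xP] := distributive_chinese_remainder (s := enum K) (c := c)
    (I := ker pi k) _ (distr k).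
- by move=> _ [l _ <-]; exact: subgroup_ker.
- rewrite mem_enum => /neq lk.
  by apply: sub_generated_lattice; exists l.
- rewrite !mem_enum => lK mK.
  have [<-|lm] := eqVneq l m.
    rewrite subrr; exact: (subgroup_add_set (subgroup_ker _ _) (subgroup_ker _ _)).1.
  (* The common extension [x] of [b l] and [b m] splits [c l - c m] into [c l - x] and [x - c m],
     one in each kernel. *)
  have [x [lx mx]] := ext l m k _ _ lm (neq l lK) (neq m mK) (comp l m lK mK lm).
  exists (c l - x); first exact/(compatible_ker _ lx)/cP.
  exists (x - c m); first exact/(compatible_ker _ (cP m mK)).
  by rewrite addrA subrK.
exists x => l lK; apply/(compatible_ker _ (cP l lK)).
by apply: xP; rewrite mem_enum.
Qed.

End Family.
Theorem theorem1 (R : comPzRingType) (J : finType)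
    (B : J -> assocAlgType R) (B2 : {set J} -> assocAlgType R)
    (pi : forall i j : J, {ahom B i -> B2 [set i; j]%SET})
    (hpi : distributive_family pi) :
  let statement2 :=
    forall (K : {set J}) (k : J) (b : forall l : J, B l),
      (K \proper [set: J])%SET -> k \notin K ->
      (forall i j, i \in K -> j \in K -> i != j ->
         compatible pi i j (b i) (b j)) ->
      exists bk : B k, forall l, l \in K -> compatible pi l k (b l) bk in
  let statement3 :=
    forall (i j k : J) (bi : B i) (bj : B j),
      i != j -> i != k -> j != k ->
      compatible pi i j bi bj ->
      exists bk : B k, compatible pi i k bi bk /\ compatible pi j k bj bk in
  (cocycle_condition pi <-> statement2) /\ (statement2 <-> statement3).
Proof.
move=> statement2 statement3; have [surj _] := hpi.
have s23 : statement2 -> statement3.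
  move=> ext i j k bi bj ij ik jk comp.
  (* Statement (2) takes a family over all of [J], so the pair is padded with zeros. *)
  pose b := dfwith (dfwith (fun l => 0 : B l) i bi) j bj.
  have bjE : b j = bj by rewrite /b dfwithin.
  have biE : b i = bi by rewrite /b dfwithout 1?eq_sym // dfwithin.
  have kK : k \notin [set i; j]%SET by rewrite !inE negb_or ![k == _]eq_sym ik jk.
  have [|//|i' j'|bk bkP] := ext [set i; j]%SET k b.
  - by rewrite properT; apply: contraNneq kK => ->; rewrite inE.
  - rewrite !inE => /orP[]/eqP -> /orP[]/eqP ->; rewrite ?eqxx // biE bjE // => _.
    exact: compatible_sym.
  by exists bk; rewrite -biE -bjE; split; apply: bkP; rewrite !inE eqxx ?orbT.
have s32 : statement3 -> statement2.
  by move=> ext K k b _; exact: triple_extension_family.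
have s13 : cocycle_condition pi -> statement3 by exact: cocycle_triple_extension.
have s31 : statement3 -> cocycle_condition pi by exact: triple_extension_cocycle.
by split; split; auto.
Qed.
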